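(* For every peak composition $\alpha$, the map $\tilde f_\alpha:\mathrm{SPYCT}(\alpha)\to\mathsf{W}_{\mathrm{SPYCT}(\alpha)}$ is bijective. Furthermore, $\bar\iota\circ\tilde f_\alpha=f_\alpha\circ\iota$ as maps $\mathrm{SPYCT}(\alpha)\to\mathsf{W}_{\mathrm{SYCT}(\alpha)}$, where $\iota:\mathrm{SPYCT}(\alpha)\to\mathrm{SYCT}(\alpha)$ is the natural injection and $\bar\iota:\mathsf{W}_{\mathrm{SPYCT}(\alpha)}\to\mathsf{W}_{\mathrm{SYCT}(\alpha)}$ is $w\mapsto\mathrm{ps}(w)$.
   Context: A composition $\alpha=(\alpha_1,\dots,\alpha_k)$ of $n$ is a finite list of positive integers with sum $n$; $\ell(\alpha)=k$. The diagram $D(\alpha)$ is the left-justified array with $\alpha_i$ boxes in row $i$, rows numbered from bottom to top; box $(i,j)$ lies in column $i$ and row $j$, and $T_{i,j}$ is the entry of $T$ there. $c_i(\alpha)$ is the number of boxes in column $i$ and $\alpha_{\max}$ is the largest part of $\alpha$. A peak composition is a composition all of whose parts, except possibly the last, are greater than $1$. $\mathrm{SYCT}(\alpha)$ is the set of standard Young composition tableaux of shape $\alpha$: fillings of $D(\alpha)$ with $1,\dots,n$ (each once), rows increasing from left to right, first column increasing from bottom to top, such that whenever $i<j$, $(k,j),(k+1,i)\in D(\alpha)$ and $T_{k,j}\le T_{k+1,i}$, then $(k+1,j)\in D(\alpha)$ and $T_{k+1,j}<T_{k+1,i}$. For a peak composition $\alpha$, $\mathrm{SPYCT}(\alpha)$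 is the set of $T\in\mathrm{SYCT}(\alpha)$ such that for every $1\le k\le n$ the boxes with entries $\le k$ form the diagram of a peak composition. A lattice word is a word in positive integers in which every prefix contains, for each $i\ge1$, at least as many $i$'s as $(i+1)$'s. For a lattice word $w=w_1\cdots w_l$, let $p_{i,1}<\cdots<p_{i,r_i}$ be the positions of the letter $i$. Define $\mathrm{rs}(w)=a_1\cdots a_l$ recursively: $a_{p_{1,k}}:=k$ for $1\le k\le r_1$; for $i\ge2$ and $k=1,\dots,r_i$ in order, $a_{p_{i,k}}:=\max A_k$, where $A_k=\{a_{p_{i-1,j}}\mid 1\le j\le r_{i-1},\ p_{i-1,j}<p_{i,k}\}\setminus\{a_{p_{i,j}}\mid1\le j\le k-1\}$. $\mathsf{W}_{\mathrm{SYCT}(\alpha)}$: the set of lattice words $w$ with letters in $\{1,\dots,\alpha_{\max}\}$, each $i$ appearing exactly $c_i(\alpha)$ times, such that each $1\le j\le\ell(\alpha)$ appears exactly $\alpha_j$ times in $\mathrm{rs}(w)$. The map $f_\alpha:\mathrm{SYCT}(\alpha)\to\mathsf{W}_{\mathrm{SYCT}(\alpha)}$ sends $T$ to the word whose $i$th letter is the index of the column of $T$ containing $i$. A peak lattice word is a lattice word in which every prefix satisfies $\#(\text{occurrences of }1)\ge2\cdot\#(\text{occurrences of }2)$. For a peak lattice word $w=w_1\cdots w_n$, $\mathrm{ps}(w)=v_1\cdots v_n$ where $v_i=1$ if $w_i=1$ and the number of $1$'s preceding $w_i$ is even; $v_i=2$ if $w_i=1$ and the number of $1$'s preceding $w_i$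 is odd; $v_i=w_i+1$ if $w_i\ne1$. $\mathsf{W}_{\mathrm{SPYCT}(\alpha)}$: the set of peak lattice words $w$ having exactly $c_1(\alpha)+c_2(\alpha)$ occurrences of $1$ and $c_{i+1}(\alpha)$ occurrences of $i$ for $2\le i\le\alpha_{\max}-1$ (and no other letters), such that each $1\le j\le\ell(\alpha)$ appears exactly $\alpha_j$ times in $\mathrm{rs}(\mathrm{ps}(w))$. The map $\tilde f_\alpha$ sends $T\in\mathrm{SPYCT}(\alpha)$ to the word whose $i$th letter is $1$ if $i$ is in the first or second column of $T$, and otherwise the index of the column of $T$ containing $i$, minus $1$. *)

(* Defs.v *)
From mathcomp Require Import all_boot.
From mathcomp Require Import boolp classical_sets functions.

Set Implicit Arguments.
Unset Strict Implicit.
Unset Printing Implicit Defensive.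

Local Open Scope classical_set_scope.
Local Open Scope nat_scope.

(* Compositions, words and tableau rows are sequences of naturals.  Rows,
   columns, parts and entries are numbered from 1 as in combinatorial usage, so
   the j-th part of alpha is [nth 0 alpha j.-1].  The integer n of which alpha
   is a composition is [sumn alpha]. *)

Definition composition (alpha : seq nat) : bool := all (fun a => 0 < a) alpha.

Definition peak_composition (alpha : seq nat) : Prop :=
  composition alpha /\
  forall j, 1 <= j < size alpha -> 1 < nth 0 alpha j.-1.

Definition max_part (alpha : seq nat) : nat := \max_(a <- alpha) a.

Definition col_size (i : nat) (alpha : seq nat) : nat :=
  count (fun a => i <= a) alpha.

(* [in_diagram alpha i j]: the box in column i and row j belongs to D(alpha). *)
Definition in_diagram (alpha : seq nat) (i j : nat) : bool :=
  [&& 1 <= i, 1 <= j <= size alpha & i <= nth 0 alpha j.-1].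

(* A filling of D(alpha) is the sequence of its rows, from bottom to top, each
   read from left to right; its shape is alpha. *)
Definition entry (T : seq (seq nat)) (i j : nat) : nat :=
  nth 0 (nth [::] T j.-1) i.-1.

Definition SYCT (alpha : seq nat) : set (seq (seq nat)) :=
  [set T | [/\ shape T = alpha,
               perm_eq (flatten T) (iota 1 (sumn alpha)),
               all (sorted ltn) T,
               sorted ltn [seq head 0 row | row <- T] &
               forall i j k : nat, i < j ->
                 in_diagram alpha k j -> in_diagram alpha k.+1 i ->
                 entry T k j <= entry T k.+1 i ->
                 in_diagram alpha k.+1 j /\ entry T k.+1 j < entry T k.+1 i]].

Definition SPYCT (alpha : seq nat) : set (seq (seq nat)) :=
  [set T | SYCT alpha T /\
     forall k, 1 <= k <= sumn alpha ->
       exists2 beta, peak_composition beta &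
         forall i j, in_diagram beta i j =
                     in_diagram alpha i j && (entry T i j <= k)].

Definition lattice_word (w : seq nat) : Prop :=
  all (fun x => 1 <= x) w /\
  forall u, prefix u w -> forall i, 1 <= i -> count_mem i.+1 u <= count_mem i u.

Definition peak_lattice_word (w : seq nat) : Prop :=
  lattice_word w /\
  forall u, prefix u w -> 2 * count_mem 2 u <= count_mem 1 u.

(* Increasing list of the positions of the letter i in w.  Positions, unlike
   everything else, start at 0. *)
Definition positions (w : seq nat) (i : nat) : seq nat :=
  [seq p <- iota 0 (size w) | nth 0 w p == i].

(* [rs_labels w i] lists a_{p_{i,1}}, a_{p_{i,2}}, ... where p_{i,1} < p_{i,2}
   < ... are the positions of the letter i in w.  In the recursive case [acc]
   holds the labels of the previous occurrences of i.  The maximum is over a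
   nonempty set whenever w is a lattice word; otherwise it defaults to 0. *)
Fixpoint rs_labels (w : seq nat) (i : nat) : seq nat :=
  match i with
  | 0 => [::]
  | 1 => iota 1 (count_mem 1 w)
  | i'.+1 =>
      foldl (fun acc p =>
               let A := [seq x.2 | x <- zip (positions w i') (rs_labels w i')
                                 & (x.1 < p) && (x.2 \notin acc)] in
               rcons acc (\max_(a <- A) a))
            [::] (positions w i)
  end.

Definition rs (w : seq nat) : seq nat :=
  [seq let i := nth 0 w p in nth 0 (rs_labels w i) (index p (positions w i))
  | p <- iota 0 (size w)].

Definition ps (w : seq nat) : seq nat :=
  [seq let x := nth 0 w p in
       if x == 1 then (if odd (count_mem 1 (take p w)) then 2 else 1) else x.+1
  | p <- iota 0 (size w)].

Definition has_content (alpha v : seq nat) : Prop :=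
  forall j, 1 <= j <= size alpha -> count_mem j v = nth 0 alpha j.-1.

Definition W_SYCT (alpha : seq nat) : set (seq nat) :=
  [set w | [/\ lattice_word w,
               all (fun x => 1 <= x <= max_part alpha) w,
               forall i, 1 <= i <= max_part alpha ->
                 count_mem i w = col_size i alpha &
               has_content alpha (rs w)]].

Definition W_SPYCT (alpha : seq nat) : set (seq nat) :=
  [set w | [/\ peak_lattice_word w,
               count_mem 1 w = col_size 1 alpha + col_size 2 alpha,
               forall i, 2 <= i <= (max_part alpha).-1 ->
                 count_mem i w = col_size i.+1 alpha,
               all (fun x => (x == 1) || (2 <= x <= (max_part alpha).-1)) w &
               has_content alpha (rs (ps w))]].

(* Index of the column of T containing k: the place of k in its row. *)
Definition column_of (T : seq (seq nat)) (k : nat) : nat :=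
  (index k (nth [::] T (find (fun row => k \in row) T))).+1.

Definition f_map (alpha : seq nat) (T : seq (seq nat)) : seq nat :=
  [seq column_of T k | k <- iota 1 (sumn alpha)].

Definition ftilde_map (alpha : seq nat) (T : seq (seq nat)) : seq nat :=
  [seq let c := column_of T k in if c <= 2 then 1 else c.-1
  | k <- iota 1 (sumn alpha)].

(* The two injections; their being maps between the intended sets is part of
   the statements that use them. *)
Definition iota_map (T : seq (seq nat)) : seq (seq nat) := T.

Definition iotabar_map (w : seq nat) : seq nat := ps w.

(* Main.v *)
(* Along T in SYCT(alpha), the tableau conditions say exactly that the row of an
   entry in column i+1 is the largest row index already present in column i and
   not yet present in column i+1; this is the recursion defining rs, so rs (f T)
   lists the rows of 1, ..., n and T is recovered from f T.  Conversely, in a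
   lattice word the positions sharing an rs-label carry the letters 1, 2, 3, ...
   in order, hence they form the rows of a tableau.

   The condition singling out SPYCT(alpha) inside SYCT(alpha) only involves the
   first two columns: at each stage at most one row has its first box filled and
   its second box not, i.e. the letters 1 and 2 of f T alternate.  Such words are
   those in which 1's and 2's can be merged and recovered by parity, which is
   what ps does. *)
Require Import Defs.
From mathcomp Require Import all_boot.
From mathcomp Require Import boolp classical_sets functions.
From mathcomp Require Import zify.

(** * The recursion defining rs *)

Lemma bigmax_seq_mem (A : seq nat) : A != [::] -> \max_(a <- A) a \in A.
Proof.
elim: A => [//|a [|b A] IH] _; first by rewrite big_seq1 mem_head.
rewrite big_cons inE; case: leqP => _; last by rewrite eqxx.
by rewrite IH // orbT.
Qed.

Lemma leq_bigmax_seq_mem (A : seq nat) x : x \in A -> x <= \max_(a <- A) a.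
Proof. by move=> xA; apply: (leq_bigmax_seq (F := id)). Qed.

Lemma bigmax_seq_eq (A : seq nat) x :
  x \in A -> {in A, forall y, y <= x} -> \max_(a <- A) a = x.
Proof.
move=> xA leA; apply/eqP; rewrite eqn_leq leq_bigmax_seq_mem // andbT.
by apply/bigmax_leqP_seq => y yA _; apply: leA.
Qed.

Section FoldlRcons.
Variables (G : seq nat -> nat -> nat).
Let F s := foldl (fun acc p => rcons acc (G acc p)) [::] s.

Lemma size_foldl_rcons s : size (F s) = size s.
Proof.
elim/last_ind: s => [//|s p IH].
by rewrite /F foldl_rcons !size_rcons -/(F s) IH.
Qed.

(** [rcons] never alters earlier entries, so the accumulator seen at step [k] is the prefix of
    length [k] of the final list. *)
Lemma nth_foldl_rcons s k :
  k < size s -> nth 0 (F s) k = G (take k (F s)) (nth 0 s k).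
Proof.
elim/last_ind: s => [//|s p IH].
rewrite /F foldl_rcons -/(F s) size_rcons ltnS leq_eqVlt => /predU1P[->|ks].
  rewrite !nth_rcons size_foldl_rcons ltnn eqxx.
  by rewrite -cats1 take_size_cat ?size_foldl_rcons.
rewrite !nth_rcons size_foldl_rcons ks IH // -cats1 takel_cat //.
by rewrite size_foldl_rcons ltnW.
Qed.

End FoldlRcons.

(** * Occurrences of a letter before a given position *)

Definition positions_before (w : seq nat) (i p : nat) : seq nat :=
  [seq q <- iota 0 p | nth 0 w q == i].

Lemma mem_positions_before w i p q :
  (q \in positions_before w i p) = (nth 0 w q == i) && (q < p).
Proof. by rewrite mem_filter mem_iota. Qed.

Lemma count_take_succ (w : seq nat) a p : p < size w ->
  count_mem a (take p.+1 w) = count_mem a (take p w) + (nth 0 w p == a).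
Proof. by move=> pw; rewrite (take_nth 0) // -cats1 count_cat /= addn0. Qed.

Lemma leq_count_take (w : seq nat) a m m' : m <= m' ->
  count_mem a (take m w) <= count_mem a (take m' w).
Proof.
move=> mm'; rewrite -[take m' w](cat_take_drop m) take_takel // count_cat.
exact: leq_addr.
Qed.

Lemma count_take_lt (w : seq nat) a p : p < size w -> nth 0 w p = a ->
  count_mem a (take p w) < count_mem a w.
Proof.
move=> pw wp; have := leq_count_take w a _ _ pw.
by rewrite count_take_succ // wp eqxx addn1 take_size.
Qed.

Lemma size_positions_before w i p : p <= size w ->
  size (positions_before w i p) = count_mem i (take p w).
Proof.
move=> pw; rewrite size_filter -[in RHS](mkseq_nth 0 (take p w)) count_map.
rewrite size_takel //; apply: eq_in_count => q; rewrite mem_iota /= => qp.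
by rewrite nth_take.
Qed.

Lemma positionsE w i : positions w i = positions_before w i (size w).
Proof. by []. Qed.

Lemma mem_positions w i p : (p \in positions w i) = (nth 0 w p == i) && (p < size w).
Proof. exact: mem_positions_before. Qed.

Lemma positions_cat w i p : p < size w -> exists s,
  positions w i = positions_before w i p ++ s.
Proof.
move=> pw; rewrite positionsE /positions_before -(subnKC (ltnW pw)) iotaD.
by rewrite filter_cat; eexists.
Qed.

Lemma index_positions w p : p < size w ->
  index p (positions w (nth 0 w p)) = size (positions_before w (nth 0 w p) p).
Proof.
move=> pw; have := subnKC pw; rewrite addSnnS.
rewrite positionsE /positions_before => {1}<-; rewrite iotaD /= filter_cat /=.
by rewrite eqxx index_cat mem_filter mem_iota ltnn !andbF /= eqxx addn0.
Qed.

Lemma filter_positions_lt w i p : p <= size w ->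
  [seq q <- positions w i | q < p] = positions_before w i p.
Proof.
move=> pw; rewrite /positions -(subnKC pw) iotaD !filter_cat add0n.
rewrite -[RHS]cats0 /positions_before; congr cat.
  by apply/all_filterP/allP => q; rewrite mem_filter mem_iota => /andP[].
rewrite -filter_predI -(filter_pred0 (iota p (size w - p))).
by apply: eq_in_filter => q; rewrite mem_iota => /andP[pq _] /=; rewrite ltnNge pq.
Qed.

Lemma size_rs_labels w i : 0 < i -> size (rs_labels w i) = size (positions w i).
Proof.
case: i => [//|[|i]] _; last exact: size_foldl_rcons.
by rewrite size_iota positionsE size_positions_before // take_size.
Qed.

Lemma size_rs w : size (rs w) = size w.
Proof. by rewrite size_map size_iota. Qed.

Lemma nth_rs w p : p < size w -> nth 0 (rs w) p =
  nth 0 (rs_labels w (nth 0 w p)) (size (positions_before w (nth 0 w p) p)).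
Proof.
by move=> pw; rewrite (nth_map 0) ?size_iota //= nth_iota //= index_positions.
Qed.

(** Expresses the auxiliary label lists through the word [rs w], so that the recursion can be
    restated without them. *)
Lemma rs_labelsE w i : 0 < i ->
  rs_labels w i = [seq nth 0 (rs w) p | p <- positions w i].
Proof.
move=> i0; apply: (@eq_from_nth _ 0); first by rewrite size_map size_rs_labels.
move=> k; rewrite size_rs_labels // => kp; rewrite (nth_map 0) //.
have := mem_nth 0 kp; rewrite mem_positions => /andP[/eqP wk lk].
rewrite nth_rs // -index_positions // wk index_uniq //.
exact/filter_uniq/iota_uniq.
Qed.

Lemma rs_one w p : p < size w -> nth 0 w p = 1 ->
  nth 0 (rs w) p = (count_mem 1 (take p w)).+1.
Proof.
move=> pw wp; rewrite nth_rs // wp /= size_positions_before ?(ltnW pw) //.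
by rewrite nth_iota // count_take_lt.
Qed.

(** The set of the recursion from which an occurrence of [i.+1] at position [p] takes its label,
    read off from [rs w]. *)
Definition rs_candidates (w : seq nat) (i p : nat) : seq nat :=
  [seq a <- [seq nth 0 (rs w) q | q <- positions_before w i p]
     | a \notin [seq nth 0 (rs w) q | q <- positions_before w i.+1 p]].

Lemma rs_candidatesP w i p a : reflect
  ((exists q, [/\ q < p, nth 0 w q = i & a = nth 0 (rs w) q]) /\
   (forall q, q < p -> nth 0 w q = i.+1 -> nth 0 (rs w) q <> a))
  (a \in rs_candidates w i p).
Proof.
rewrite mem_filter; apply: (iffP andP) => [[an /mapP[q]]|[[q [qp wq ->]] an]].
  rewrite mem_positions_before => /andP[/eqP wq qp] ea; subst a.
  split; first by exists q.
  move=> r rp wr e; case/mapP: an; exists r => //.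
  by rewrite mem_positions_before wr eqxx.
split; last by apply/mapP; exists q => //; rewrite mem_positions_before wq eqxx.
apply/mapP => -[r]; rewrite mem_positions_before => /andP[/eqP wr rp] e.
exact: (an r).
Qed.

(** When the fold reaches [p], its accumulator holds the labels of the earlier occurrences of
    [i.+2], so the list maximised there is the list of candidates. *)
Lemma rs_succ w p i : p < size w -> nth 0 w p = i.+2 ->
  nth 0 (rs w) p = \max_(a <- rs_candidates w i.+1 p) a.
Proof.
move=> pw wp; have [s es] := positions_cat w i.+2 p pw.
have kp : size (positions_before w i.+2 p) < size (positions w i.+2).
  by rewrite -wp -index_positions // index_mem mem_positions eqxx.
pose G (acc : seq nat) p := \max_(a <- [seq x.2 | x <- zip (positions w i.+1) (rs_labels w i.+1)
                                 & (x.1 < p) && (x.2 \notin acc)]) a.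
have := nth_foldl_rcons G _ _ kp.
rewrite -[foldl _ _ _]/(rs_labels w i.+2) nth_rs // wp => ->.
rewrite /G (rs_labelsE w i.+2) // (rs_labelsE w i.+1) // -map_take {2}es take_size_cat //.
have -> : nth 0 (positions w i.+2) (size (positions_before w i.+2 p)) = p.
  by rewrite -wp -index_positions // nth_index // mem_positions eqxx.
rewrite -[X in zip X]map_id zip_map filter_map -map_comp /=.
rewrite /rs_candidates filter_map -(filter_positions_lt w i.+1 p) ?(ltnW pw) //.
rewrite -filter_predI.
by congr (\big[_/_]_(_ <- map _ _) _); apply: eq_filter => q /=; rewrite andbC.
Qed.

(** * Labels of lattice words *)

Lemma lattice_take w m i : lattice_word w -> 0 < i ->
  count_mem i.+1 (take m w) <= count_mem i (take m w).
Proof. by case=> _; apply; apply: prefix_take. Qed.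

Definition rs_inj_on (w : seq nat) (i : nat) :=
  forall p q, p < size w -> q < size w -> nth 0 w p = i -> nth 0 w q = i ->
    nth 0 (rs w) p = nth 0 (rs w) q -> p = q.

(** Pigeonhole: without candidates, every label of an [i.+1] before [p] also labels an [i.+2] before
    [p]. Since the former are distinct, the occurrence at [p] would break the lattice condition for
    the prefix of length [p.+1]. *)
Lemma rs_candidates_neq0 w i p : lattice_word w -> rs_inj_on w i.+1 ->
  p < size w -> nth 0 w p = i.+2 -> rs_candidates w i.+1 p != [::].
Proof.
move=> lw inj pw wp; apply/eqP => A0; have pw' := ltnW pw.
suff : size (positions_before w i.+1 p) <= size (positions_before w i.+2 p).
  rewrite !size_positions_before //.
  have := lattice_take w p.+1 i.+1 lw isT.
  by rewrite !count_take_succ // wp eqxx eqn_leq ltnn /=; lia.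
rewrite -(size_map (nth 0 (rs w))) -(size_map (nth 0 (rs w)) (positions_before w i.+2 p)).
apply: uniq_leq_size => [|a ai].
  rewrite map_inj_in_uniq; first exact/filter_uniq/iota_uniq.
  move=> q r; rewrite !mem_positions_before => /andP[/eqP wq qp] /andP[/eqP wr rp].
  by apply: inj => //; [apply: ltn_trans qp _|apply: ltn_trans rp _].
by apply/negPn/negP => an; have := in_nil a; rewrite -A0 mem_filter an ai.
Qed.

(** Induction on the letter. Labels of 1 count upwards; for a larger letter the maximum is a genuine
    candidate, by the induction hypothesis, and candidates avoid the labels already given to that
    letter. *)
Lemma rs_inj w i : lattice_word w -> 0 < i -> rs_inj_on w i.
Proof.
move=> lw; case: i => // i _; elim: i => [|i IH] p q.
  wlog pq : p q / p < q => [H|pw qw wp wq].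
    case: (ltngtP p q) => // pq pw qw wp wq e; first exact: H.
    by apply/esym/H.
  rewrite !rs_one // => -[e].
  have := leq_count_take w 1 _ _ pq.
  by rewrite count_take_succ // wp e addn1 ltnn.
wlog pq : p q / p < q => [H|pw qw wp wq].
  case: (ltngtP p q) => // pq pw qw wp wq e; first exact: H.
  by apply/esym/H.
rewrite [RHS](rs_succ w q i) // => e.
have /rs_candidatesP[_ /(_ p pq wp)] :=
  bigmax_seq_mem _ (rs_candidates_neq0 w i q lw IH qw wq).
by rewrite e.
Qed.

Lemma rs_pred w i p : lattice_word w -> p < size w -> nth 0 w p = i.+2 ->
  exists q, [/\ q < p, nth 0 w q = i.+1 & nth 0 (rs w) q = nth 0 (rs w) p].
Proof.
move=> lw pw wp.
have inj : rs_inj_on w i.+1 by apply: rs_inj.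
have /rs_candidatesP[[q [qp wq e]] _] :=
  bigmax_seq_mem _ (rs_candidates_neq0 w i p lw inj pw wp).
by exists q; rewrite (rs_succ w p i) ?e.
Qed.

(** A larger label standing on an earlier [i.+1] is passed over only if it is already taken. This is
    the source of the last condition in [SYCT]. *)
Lemma rs_max w i p q : p < size w -> nth 0 w p = i.+2 ->
  q < p -> nth 0 w q = i.+1 -> nth 0 (rs w) p < nth 0 (rs w) q ->
  exists r, [/\ r < p, nth 0 w r = i.+2 & nth 0 (rs w) r = nth 0 (rs w) q].
Proof.
move=> pw wp qp wq lt_pq; apply: contrapT => no.
suff : nth 0 (rs w) q \in rs_candidates w i.+1 p.
  by move/leq_bigmax_seq_mem; rewrite -rs_succ // leqNgt lt_pq.
apply/rs_candidatesP; split; first by exists q.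
by move=> r rp wr e; apply: no; exists r.
Qed.

(** * From tableaux to words *)

Definition row_of (T : seq (seq nat)) (k : nat) : nat :=
  (find (fun row => k \in row) T).+1.

Lemma uniq_flatten_row (T : seq (seq nat)) a b x : uniq (flatten T) ->
  x \in nth [::] T a -> x \in nth [::] T b -> a = b.
Proof.
have mem_row (U : seq (seq nat)) c : x \in nth [::] U c -> x \in flatten U.
  move=> xc; apply/flattenP; exists (nth [::] U c) => //; apply: mem_nth.
  by rewrite ltnNge; apply/negP => cU; rewrite nth_default in xc.
elim: T a b => [|r T IH] a b; first by rewrite !nth_nil.
rewrite /= cat_uniq => /and3P[_ /hasPn rT uT].
case: a b => [|a] [|b] //= xa xb; last by rewrite (IH a b).
  by have := rT x (mem_row _ _ xb); rewrite /= xa.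
by have := rT x (mem_row _ _ xa); rewrite /= xb.
Qed.

Lemma nth_shape (T : seq (seq nat)) j : nth 0 (shape T) j = size (nth [::] T j).
Proof.
case: (ltnP j (size T)) => jT; first by rewrite (nth_map [::]).
by rewrite !nth_default // size_map.
Qed.

Lemma in_diagramE T i j :
  in_diagram (shape T) i j -> entry T i j \in nth [::] T j.-1.
Proof.
by case/and3P; case: i => // i _ _ /= ij; rewrite mem_nth // -nth_shape.
Qed.

Lemma entry_flatten T i j :
  in_diagram (shape T) i j -> entry T i j \in flatten T.
Proof.
move=> ij; apply/flattenP; exists (nth [::] T j.-1); last exact: in_diagramE.
case/and3P: ij => _ /andP[]; case: j => // j _; rewrite size_map => jT _.
exact: mem_nth.
Qed.

Section UniqueEntries.
Variables (T : seq (seq nat)) (uniqT : uniq (flatten T)).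

Lemma row_of_entry i j : in_diagram (shape T) i j -> row_of T (entry T i j) = j.
Proof.
move=> ij; have mem := in_diagramE T i j ij.
case/and3P: ij => _ /andP[]; case: j mem => // j /= mem _ jT _.
rewrite size_map in jT; congr S; apply: (uniq_flatten_row T _ _ (entry T i j.+1)) => //.
by apply: (nth_find _ (a := fun row => entry T i j.+1 \in row)); apply/hasP; exists (nth [::] T j) => //; apply: mem_nth.
Qed.

Lemma uniq_row j : uniq (nth [::] T j).
Proof.
elim: T uniqT j => [|r U IH] /=; first by move=> _ j; rewrite nth_nil.
by rewrite cat_uniq => /and3P[ur _ uU] [|j] //=; apply: IH.
Qed.

Lemma column_of_entry i j :
  in_diagram (shape T) i j -> column_of T (entry T i j) = i.
Proof.
move=> ij; rewrite /column_of.
have -> : find (fun row => entry T i j \in row) T = j.-1.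
  by rewrite -[j in RHS](row_of_entry i j ij).
case/and3P: ij; case: i => // i _ _ ij; rewrite /entry index_uniq ?uniq_row //.
by rewrite -nth_shape.
Qed.

End UniqueEntries.

Lemma row_columnP T k : k \in flatten T ->
  in_diagram (shape T) (column_of T k) (row_of T k) /\
  entry T (column_of T k) (row_of T k) = k.
Proof.
move=> /flattenP[r rT kr]; have hT : has (fun row => k \in row) T by apply/hasP; exists r.
have := nth_find [::] hT; rewrite /in_diagram /entry /column_of /row_of /= => kf.
by rewrite size_map -has_find hT nth_shape index_mem kf nth_index.
Qed.

Lemma in_diagramW alpha i i' j :
  0 < i' <= i -> in_diagram alpha i j -> in_diagram alpha i' j.
Proof.
move=> /andP[i'0 ii'] /and3P[_ jl ij]; apply/and3P; split=> //.
exact: leq_trans ij.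
Qed.

Lemma in_diagram1 alpha j : composition alpha ->
  in_diagram alpha 1 j = (1 <= j <= size alpha).
Proof.
move=> /(all_nthP 0) ca; rewrite /in_diagram /=; case: j => // j.
by rewrite -[RHS]andbT; apply: andb_id2l => /= jl; apply: ca.
Qed.

Lemma count_in_pred0 (a : pred nat) s : {in s, forall x, ~~ a x} -> count a s = 0.
Proof. by move/hasPn; rewrite has_count -eqn0Ngt => /eqP. Qed.

(** Rows beyond the last part contribute nothing. The free bound [m] allows the columns of two
    compositions to be counted over the same rows. *)
Lemma col_sizeE alpha i m : 0 < i -> size alpha <= m ->
  col_size i alpha = count (in_diagram alpha i) (iota 1 m).
Proof.
move=> i0 am; rewrite -(subnKC am) iotaD count_cat [X in _ + X]count_in_pred0.
  rewrite addn0 /col_size -{1}(mkseq_nth 0 alpha) count_map (iotaDl 1 0) count_map.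
  apply: eq_in_count => j; rewrite mem_iota /in_diagram i0 /= add0n => jl.
  by rewrite addnC addn1 jl.
move=> j; rewrite mem_iota add1n => /andP[lj _].
by rewrite /in_diagram (leqNgt j) lj /= !andbF.
Qed.

Section SYCT.
Variables (alpha : seq nat) (T : seq (seq nat)).
Hypotheses (comp_alpha : composition alpha) (TS : SYCT alpha T).

Let n := sumn alpha.

Lemma SYCT_shape : shape T = alpha. Proof. by case: TS. Qed.

Lemma SYCT_uniq : uniq (flatten T).
Proof. by case: TS => _ /perm_uniq -> *; apply: iota_uniq. Qed.

Lemma SYCT_flatten k : (k \in flatten T) = (1 <= k <= n).
Proof. by case: TS => _ /perm_mem -> *; rewrite mem_iota add1n ltnS. Qed.

Lemma SYCT_entry_range i j : in_diagram alpha i j -> 1 <= entry T i j <= n.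
Proof. by rewrite -SYCT_flatten -SYCT_shape => /entry_flatten. Qed.

Lemma SYCT_row_of i j : in_diagram alpha i j -> row_of T (entry T i j) = j.
Proof. by rewrite -SYCT_shape; apply: row_of_entry; apply: SYCT_uniq. Qed.

Lemma SYCT_column_of i j : in_diagram alpha i j -> column_of T (entry T i j) = i.
Proof. by rewrite -SYCT_shape; apply: column_of_entry; apply: SYCT_uniq. Qed.

Lemma SYCT_box k : 1 <= k <= n -> in_diagram alpha (column_of T k) (row_of T k).
Proof.
rewrite -SYCT_flatten => /row_columnP; rewrite SYCT_shape.
by case.
Qed.

Lemma SYCT_entry k : 1 <= k <= n -> entry T (column_of T k) (row_of T k) = k.
Proof. by rewrite -SYCT_flatten => /row_columnP; case. Qed.

Lemma SYCT_row_lt i i' j : 0 < i < i' -> in_diagram alpha i' j ->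
  entry T i j < entry T i' j.
Proof.
case/andP; case: i => // i _; case: i' => // i' ii'.
rewrite -SYCT_shape => /and3P[_ /andP[]]; case: j => // j _; rewrite size_map => jT /=.
rewrite nth_shape => i'j; case: TS => _ _ /(all_nthP [::]) /(_ j jT) srt _ _.
by apply: (sorted_ltn_nth ltn_trans 0 srt); rewrite ?inE //; apply: ltn_trans i'j.
Qed.

Lemma SYCT_column1_lt j j' : 0 < j < j' -> in_diagram alpha 1 j' ->
  entry T 1 j < entry T 1 j'.
Proof.
case/andP; case: j => // j _; case: j' => // j' jj'.
rewrite -SYCT_shape => /and3P[_ /andP[_]]; rewrite size_map => j'T /= _.
have jT : j < size T by apply: ltn_trans j'T.
case: TS => _ _ _ srt _; have := sorted_ltn_nth ltn_trans 0 srt j j'.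
by rewrite !inE size_map !(nth_map [::]) // -!nth0; apply.
Qed.

Lemma size_f_map : size (f_map alpha T) = n.
Proof. by rewrite size_map size_iota. Qed.

Lemma nth_f_map p : p < n -> nth 0 (f_map alpha T) p = column_of T p.+1.
Proof. by move=> pn; rewrite (nth_map 0) ?size_iota // nth_iota // add1n. Qed.

(** Each row has at most one box in column [i], so [row_of] is injective on the entries of that
    column. *)
Lemma count_f_map i m N : m <= n -> size alpha <= N ->
  count_mem i (take m (f_map alpha T)) =
  count (fun j => in_diagram alpha i j && (entry T i j <= m)) (iota 1 N).
Proof.
move=> mn aN; rewrite -map_take take_iota (minn_idPl mn) count_map -!size_filter.
have inI k : (k \in iota 1 m) -> 1 <= k <= n.
  by rewrite mem_iota add1n ltnS => /andP[-> km]; apply: leq_trans km mn.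
rewrite -(size_map (row_of T)); apply/perm_size/uniq_perm.
- rewrite map_inj_in_uniq; first exact/filter_uniq/iota_uniq.
  move=> k k'; rewrite !mem_filter => /andP[/eqP ck /inI kn] /andP[/eqP ck' /inI k'n] e.
  by rewrite -[k]SYCT_entry // -[k']SYCT_entry // ck ck' e.
- exact/filter_uniq/iota_uniq.
move=> j; apply/mapP/idP => [[k]|].
  rewrite !mem_filter => /andP[/eqP ck kI] ->; have kn := inI k kI.
  have box := SYCT_box k kn; rewrite ck in box.
  rewrite -{2}ck SYCT_entry // box mem_iota add1n ltnS /=.
  case/and3P: (box) => _ /andP[_ rl] _; rewrite (leq_trans rl aN) andbT.
  by move: kI; rewrite mem_iota add1n ltnS => /andP[].
rewrite mem_filter => /andP[/andP[box em] _].
exists (entry T i j); last by rewrite SYCT_row_of.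
rewrite mem_filter /= SYCT_column_of // eqxx mem_iota add1n ltnS em.
by case/andP: (SYCT_entry_range i j box) => ->.
Qed.

(** Strong induction on the position. In column 1 the label counts the rows already started. Further
    right, the row of the entry is a candidate, since its left neighbour is smaller and its own box
    is filled only now; the last condition in [SYCT] excludes candidates in higher rows. *)
Lemma nth_rs_f_map p : p < n ->
  nth 0 (rs (f_map alpha T)) p = row_of T p.+1.
Proof.
have [q] := ubnP p; elim: q p => // q IH p; rewrite ltnS => pq pn.
have box := SYCT_box p.+1 pn; have ent := SYCT_entry p.+1 pn.
have wp := nth_f_map p pn; have pw : p < size (f_map alpha T) by rewrite size_f_map.
case ci : (column_of T p.+1) => [|[|i]] //; rewrite ci in box ent wp.
  rewrite rs_one // (count_f_map 1 p (size alpha)) ?(ltnW pn) //.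
  case er : (row_of T p.+1) box ent => [//|r] box ent.
  have /and3P[_ /= rl _] := box.
  (* Rows are split at [r]: the first [r] rows have first entry at most [p], while row [r.+1] starts
     with [p.+1] and later rows start with more. *)
  rewrite -(subnKC (ltnW rl)) iotaD count_cat.
  rewrite [X in _ + X]count_in_pred0 ?addn0 => [|j].
    congr S; rewrite -[RHS](size_iota 1); apply/eqP; rewrite -all_count.
    apply/allP => j; rewrite mem_iota add1n => /andP[j0 jr].
    rewrite in_diagram1 // j0 (leq_trans (ltnW jr) rl) /= -ltnS -ent.
    by rewrite SYCT_column1_lt ?j0.
  rewrite mem_iota add1n => /andP[rj _].
  case bj : (in_diagram alpha 1 j) => //=; rewrite -ltnNge.
  move: rj; rewrite leq_eqVlt => /predU1P[<-|rj]; first by rewrite ent.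
  by rewrite -ent ltnW // SYCT_column1_lt.
rewrite (rs_succ _ _ i) //; apply: bigmax_seq_eq.
  apply/rs_candidatesP.
  have box' : in_diagram alpha i.+1 (row_of T p.+1).
    by apply: (in_diagramW _ _ _ _ _ box); rewrite /= leqnSn.
  have lt : entry T i.+1 (row_of T p.+1) < p.+1.
    by rewrite -{2}ent SYCT_row_lt //= ltnSn.
  have /andP[e0 en] := SYCT_entry_range _ _ box'.
  set k := entry _ _ _ in lt e0 en; have ek : k.-1.+1 = k by rewrite prednK.
  have kp : k.-1 < p by rewrite -ltnS ek.
  split; first exists k.-1.
    by split=> //; rewrite ?nth_f_map ?IH ?ek ?SYCT_column_of ?SYCT_row_of //;
       lia.
  move=> r rp; have rn : r < n by lia.
  rewrite nth_f_map // IH //; last by lia.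
  move=> cr er; have := SYCT_entry r.+1 rn; rewrite cr er ent.
  by move=> [e]; rewrite e ltnn in rp.
move=> a /rs_candidatesP[[r [rp + ->]] no]; have rn : r < n by lia.
rewrite nth_f_map // IH // in no *; last by lia.
move=> cr; rewrite leqNgt; apply/negP => lt.
have boxr := SYCT_box r.+1 rn; rewrite cr in boxr.
have entr := SYCT_entry r.+1 rn; rewrite cr in entr.
(* A candidate in a higher row has its next box filled before [p.+1], so its label was already
   taken. *)
case: TS => _ _ _ _ /(_ _ _ _ lt boxr box); rewrite ent entr.
case; first exact: ltnW.
move=> box2 lt2; have /andP[e0 en] := SYCT_entry_range _ _ box2.
set k := entry _ _ _ in lt2 e0 en; have ek : k.-1.+1 = k by rewrite prednK.
apply: (no k.-1); first by lia.
  by rewrite nth_f_map ?ek ?SYCT_column_of //; lia.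
by rewrite IH ?ek ?SYCT_row_of //; lia.
Qed.

Lemma rs_f_map : rs (f_map alpha T) = [seq row_of T k | k <- iota 1 n].
Proof.
apply: (@eq_from_nth _ 0); first by rewrite size_rs size_f_map size_map size_iota.
move=> p; rewrite size_rs size_f_map => pn.
by rewrite nth_rs_f_map // (nth_map 0) ?size_iota // nth_iota // add1n.
Qed.

Lemma count_f_map_all i : 0 < i ->
  count_mem i (f_map alpha T) = col_size i alpha.
Proof.
move=> i0; rewrite -[f_map _ _]take_size size_f_map (count_f_map i n (size alpha)) //.
rewrite (col_sizeE alpha i (size alpha)) //; apply: eq_count => j.
rewrite andb_idr // => /SYCT_entry_range /andP[_]; exact.
Qed.

(** A box of column [i'] has in its row a box of column [i] whose entry is no larger. *)
Lemma count_f_map_le i i' m : m <= n -> 0 < i <= i' ->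
  count_mem i' (take m (f_map alpha T)) <= count_mem i (take m (f_map alpha T)).
Proof.
move=> mn ii'; rewrite !(count_f_map _ m (size alpha)) //.
apply: sub_count => j /andP[box em]; rewrite (in_diagramW _ _ _ _ ii' box) /=.
case/andP: ii' => i0; rewrite leq_eqVlt => /predU1P[->//|ii'].
by apply: ltnW; apply: leq_trans em; apply: SYCT_row_lt => //; apply/andP.
Qed.

Lemma f_map_W_SYCT : W_SYCT alpha (f_map alpha T).
Proof.
have ge1 : all [pred x | 1 <= x <= max_part alpha] (f_map alpha T).
  apply/allP => x /mapP[k]; rewrite mem_iota add1n ltnS => kn ->.
  have /and3P[c0 /andP[r0 rl] cr] := SYCT_box k kn.
  apply/andP; split=> //; rewrite (leq_trans cr) //; apply: (leq_bigmax_seq (F := id)) => //.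
  by apply: mem_nth; rewrite prednK.
split=> //.
- split; first by apply: sub_all ge1 => x /andP[].
  move=> u /prefixP[s e] i i0.
  have -> : u = take (size u) (f_map alpha T) by rewrite e take_size_cat.
  apply: count_f_map_le; last by rewrite i0 /=.
  by rewrite -size_f_map e size_cat leq_addr.
- by move=> i /andP[i0 _]; rewrite count_f_map_all.
(* By the formula for [rs], the occurrences of [j] correspond to the members of the [j]-th row of
   [T]. *)
move=> j /andP[j0 jl]; rewrite rs_f_map count_map -size_filter.
have jT : j.-1 < size T by rewrite prednK // -(size_map size) -/(shape T) SYCT_shape.
rewrite -SYCT_shape nth_shape; apply/perm_size/uniq_perm.
- exact/filter_uniq/iota_uniq.
- exact/uniq_row/SYCT_uniq.
move=> k; rewrite mem_filter mem_iota add1n ltnS -SYCT_flatten /=.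
apply/andP/idP => [[/eqP rk kT]|kr].
  case/flattenP: kT => r rT kr; rewrite -rk /=.
  by apply: (@nth_find _ [::] (fun row => k \in row)); apply/hasP; exists r.
have rT := mem_nth [::] jT; split; last by apply/flattenP; exists (nth [::] T j.-1).
have /(nth_find [::]) : has (fun row => k \in row) T.
  by apply/hasP; exists (nth [::] T j.-1).
by move/(uniq_flatten_row _ _ _ _ SYCT_uniq kr); rewrite /row_of => <-; rewrite prednK.
Qed.

End SYCT.

(** * From words to tableaux *)

Lemma sorted_iota1 (s : seq nat) : sorted ltn s -> {in s, forall x, 0 < x} ->
  (forall x y, x \in s -> 0 < y <= x -> y \in s) -> s = iota 1 (size s).
Proof.
move=> srt s0 down; have [->//|sn0] := eqVneq s [::].
suff e : s = iota 1 (\max_(x <- s) x) by rewrite {2}e size_iota.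
apply: (irr_sorted_eq ltn_trans ltnn srt (iota_ltn_sorted _ _)) => x.
rewrite mem_iota add1n ltnS; apply/idP/idP => [xs|xm].
  by rewrite s0 //= leq_bigmax_seq_mem.
by apply: (down (\max_(x <- s) x)) => //; apply: bigmax_seq_mem.
Qed.

(** The inverse of [f_map], applied to [v = rs w]. The successor is there because positions start at
    0 and entries at 1. *)
Definition tableau_of_labels (l : nat) (v : seq nat) : seq (seq nat) :=
  [seq [seq p.+1 | p <- positions v j] | j <- iota 1 l].

Section Inverse.
Variables (alpha w : seq nat).
Hypotheses (comp_alpha : composition alpha) (wW : W_SYCT alpha w).

Let v := rs w.
Let T := tableau_of_labels (size alpha) v.

Lemma W_SYCT_lattice : lattice_word w. Proof. by case: wW. Qed.

Lemma W_SYCT_gt0 p : p < size w -> 0 < nth 0 w p.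
Proof. by case: wW => -[/(all_nthP 0) + _ _ _ _]; apply. Qed.

Lemma W_SYCT_inj p q : p < size w -> q < size w ->
  nth 0 w p = nth 0 w q -> nth 0 v p = nth 0 v q -> p = q.
Proof.
move=> pw qw e; apply: (rs_inj w (nth 0 w p)) => //; first exact: W_SYCT_lattice.
exact: W_SYCT_gt0.
Qed.

(** Iterates [rs_pred]: from any position one goes back along its label through all smaller
    letters. *)
Lemma W_SYCT_descend i p : p < size w -> 0 < i <= nth 0 w p ->
  exists q, [/\ q <= p, nth 0 w q = i & nth 0 v q = nth 0 v p].
Proof.
move=> pw /andP[i0 /subnKC]; move: (_ - _) => d; elim: d p pw => [|d IH] p pw.
  by rewrite addn0 => ->; exists p.
case: i i0 IH => // i _ IH; rewrite addSn addnS => /esym wp.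
have [q [qp wq vq]] := rs_pred w (i + d) p W_SYCT_lattice pw wp.
have [||r [rq wr vr]] := IH q; [exact: ltn_trans pw|by rewrite wq addSn|].
by exists r; rewrite wr vr vq (leq_trans rq (ltnW qp)).
Qed.

(** If the letter at [q] were not larger, descending from [p] would reach an occurrence of it with
    the same label at or before [p]; by injectivity that position is [q]. *)
Lemma W_SYCT_label_lt p q : p < size w -> q < size w ->
  nth 0 v p = nth 0 v q -> p < q -> nth 0 w p < nth 0 w q.
Proof.
move=> pw qw vpq pq; rewrite ltnNge; apply/negP => le.
have [|r [rp wr vr]] := W_SYCT_descend (nth 0 w q) p pw.
  by rewrite W_SYCT_gt0.
have rw : r < size w by apply: leq_ltn_trans pw.
have rq : r = q by apply: W_SYCT_inj; rewrite ?vr.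
by rewrite rq leqNgt pq in rp.
Qed.

(** Descending to the letter 1 leaves only labels of 1's, which run up to the number of 1's; this is
    the size of the first column, hence the number of parts. *)
Lemma W_SYCT_label_range p : p < size w -> 1 <= nth 0 v p <= size alpha.
Proof.
move=> pw; have [|q [qp wq <-]] := W_SYCT_descend 1 p pw.
  by rewrite W_SYCT_gt0.
have qw : q < size w by apply: leq_ltn_trans pw.
rewrite rs_one //=; suff -> : size alpha = count_mem 1 w.
  exact: count_take_lt.
case: wW => _ le cnt _; rewrite cnt; first by apply/esym/eqP; rewrite -all_count.
(* The occurrence of 1 at [q] yields [1 <= max_part alpha], which the condition on letter counts
   requires. *)
by have /andP[_] := all_nthP 0 le q qw; rewrite wq.
Qed.

(** Along one label the letters increase strictly and, by descent, skip no value; their number is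
    prescribed by [has_content]. Hence the [i]-th entry of a row really lies in column [i]. *)
Lemma row_letters j : 1 <= j <= size alpha ->
  [seq nth 0 w p | p <- positions v j] = iota 1 (nth 0 alpha j.-1).
Proof.
move=> jl; have inP p : (p \in positions v j) -> p < size w /\ nth 0 v p = j.
  by rewrite mem_positions size_rs => /andP[/eqP].
have -> : nth 0 alpha j.-1 = size [seq nth 0 w p | p <- positions v j].
  rewrite size_map positionsE size_positions_before // take_size.
  by case: wW => _ _ _ <-.
apply: sorted_iota1.
- apply: (homo_sorted_in (e := ltn) (P := mem (positions v j))).
  + move=> p q /inP[pw vp] /inP[qw vq]; apply: W_SYCT_label_lt => //.
    by rewrite vp vq.
  + exact/allP.
  + exact: (sorted_filter ltn_trans _ (iota_ltn_sorted _ _)).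
- by move=> _ /mapP[p /inP[pw _] ->]; apply: W_SYCT_gt0.
move=> _ i /mapP[p /inP[pw vp] ->] iw.
have [q [qp wq vq]] := W_SYCT_descend i p pw iw.
apply/mapP; exists q => //; rewrite mem_positions size_rs vq vp eqxx.
exact: leq_ltn_trans pw.
Qed.

Lemma size_row j : 1 <= j <= size alpha -> size (positions v j) = nth 0 alpha j.-1.
Proof.
by move=> jl; rewrite -(size_map (nth 0 w)) row_letters // size_iota.
Qed.

Lemma nth_tableau_of_labels j : j < size alpha ->
  nth [::] T j = [seq p.+1 | p <- positions v j.+1].
Proof. by move=> jl; rewrite (nth_map 0) ?size_iota // nth_iota. Qed.

Lemma shape_tableau_of_labels : shape T = alpha.
Proof.
apply: (@eq_from_nth _ 0); first by rewrite !size_map size_iota.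
move=> j; rewrite !size_map size_iota => jl.
by rewrite nth_shape nth_tableau_of_labels // size_map size_row.
Qed.

Lemma box_position i j : in_diagram alpha i j -> exists p,
  [/\ p < size w, nth 0 w p = i, nth 0 v p = j & entry T i j = p.+1].
Proof.
case/and3P; case: i => // i _ /andP[]; case: j => // j _ jl /= ij.
have sz : size (positions v j.+1) = nth 0 alpha j by rewrite size_row.
exists (nth 0 (positions v j.+1) i).
have := mem_nth 0 (_ : i < size (positions v j.+1)); rewrite sz => /(_ ij).
rewrite mem_positions size_rs => /andP[/eqP vp pw]; split=> //.
  rewrite -(nth_map 0 0 (nth 0 w)) ?sz //.
  by rewrite row_letters // nth_iota.
by rewrite /entry /= nth_tableau_of_labels // (nth_map 0) ?sz.
Qed.

Lemma position_box p : p < size w ->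
  in_diagram alpha (nth 0 w p) (nth 0 v p) /\
  entry T (nth 0 w p) (nth 0 v p) = p.+1.
Proof.
move=> pw; have jl := W_SYCT_label_range p pw; have w0 := W_SYCT_gt0 p pw.
have pj : p \in positions v (nth 0 v p) by rewrite mem_positions size_rs eqxx.
have box : in_diagram alpha (nth 0 w p) (nth 0 v p).
  rewrite /in_diagram w0 jl /=.
  have := map_f (nth 0 w) pj; rewrite row_letters // mem_iota add1n ltnS.
  by case/andP.
split=> //; have [q [qw wq vq ->]] := box_position _ _ box.
by rewrite (W_SYCT_inj q p).
Qed.

Lemma perm_tableau_of_labels : perm_eq (flatten T) (iota 1 (size w)).
Proof.
have -> : flatten T = [seq p.+1 | j <- iota 1 (size alpha), p <- positions v j] by [].
apply: uniq_perm; last 2 first.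
- exact: iota_uniq.
- move=> k; apply/allpairsPdep/idP => [[j [p [_]]]|].
    by rewrite mem_positions size_rs mem_iota add1n ltnS => /andP[_ pw] ->.
  rewrite mem_iota add1n; case: k => // k; rewrite ltnS => kw.
  exists (nth 0 v k), k; split=> //; last by rewrite mem_positions size_rs eqxx.
  by rewrite mem_iota add1n ltnS W_SYCT_label_range.
apply: allpairs_uniq_dep; first exact: iota_uniq.
  by move=> j _; apply/filter_uniq/iota_uniq.
move=> x y /allpairsPdep[j [p [_ pj ->]]] /allpairsPdep[j' [p' [_ pj' ->]]] /= [e].
by subst p'; move: pj pj'; rewrite !mem_positions => /andP[/eqP <- _] /andP[/eqP <- _].
Qed.

Lemma size_W_SYCT : size w = sumn alpha.
Proof.
have /perm_size := perm_tableau_of_labels.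
by rewrite size_flatten shape_tableau_of_labels size_iota.
Qed.

(** Rows increase by construction, the first column because labels of 1 increase with the position,
    and the last condition is [rs_max]. *)
Lemma tableau_of_labels_SYCT : SYCT alpha T.
Proof.
split; first exact: shape_tableau_of_labels.
- by rewrite -size_W_SYCT perm_tableau_of_labels.
- apply/allP => _ /mapP[j _ ->]; rewrite sorted_map.
  exact: (sorted_filter ltn_trans _ (iota_ltn_sorted _ _)).
- apply/(sortedP 0) => j; rewrite size_map (size_map _ (iota _ _)) size_iota => jl.
  have jT : j.+1 < size T by rewrite size_map size_iota.
  rewrite !(nth_map [::]) ?(ltnW jT) // -!nth0.
  have [|p [pw wp vp]] := box_position 1 j.+1.
    by rewrite in_diagram1 //= (ltnW jl).
  have [|q [qw wq vq]] := box_position 1 j.+2; first by rewrite in_diagram1.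
  rewrite /entry /= => -> ->; move: vp vq; rewrite /v !rs_one // => -[cp] [cq].
  rewrite ltnS ltnNge; apply/negP => qp.
  by have := leq_count_take w 1 _ _ qp; rewrite cp cq ltnn.
move=> i j [|k] // ij kj ki.
have [p [pw wp vp ->]] := box_position _ _ kj.
have [q [qw wq vq ->]] := box_position _ _ ki.
rewrite ltnS leq_eqVlt => /predU1P[e|pq]; first by move: wq; rewrite -e wp; lia.
(* Label [j] stands on an earlier [k.+1] and exceeds the label [i] chosen at [q], so it was already
   used by some [k.+2]; this gives the required box. *)
have [|r [rq wr vr]] := rs_max w k q p qw wq pq wp; first by rewrite -/v vq vp.
have rw := ltn_trans rq qw.
have [box er] := position_box r rw.
by rewrite wr -/v vr -/v vp in box er; rewrite box er.
Qed.

Lemma f_map_tableau_of_labels : f_map alpha T = w.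
Proof.
have TS := tableau_of_labels_SYCT.
apply: (@eq_from_nth _ 0); rewrite size_f_map -?size_W_SYCT // => p pn.
rewrite nth_f_map -?size_W_SYCT //.
have [box <-] := position_box p pn.
by rewrite (SYCT_column_of alpha).
Qed.

End Inverse.

(** The word gives the column of every entry and its [rs] gives the row, so the box of every entry
    is determined. *)
Lemma f_map_inj alpha T T' : composition alpha -> SYCT alpha T -> SYCT alpha T' ->
  f_map alpha T = f_map alpha T' -> T = T'.
Proof.
move=> ca TS TS' e.
have szE : shape T = shape T' by rewrite !(SYCT_shape alpha).
have eE i j : in_diagram alpha i j -> entry T' i j = entry T i j.
  move=> box; have /andP[k0 kn] := SYCT_entry_range _ _ TS _ _ box.
  have := SYCT_row_of _ _ TS _ _ box; have := SYCT_column_of _ _ TS _ _ box.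
  case: (entry T i j) k0 kn => // p _ pn.
  rewrite -(nth_f_map alpha) // -(nth_rs_f_map alpha T) // e.
  rewrite (nth_f_map alpha) // (nth_rs_f_map alpha T') // => <- <-.
  exact: (SYCT_entry alpha).
apply: (@eq_from_nth _ [::]); first by rewrite -!(size_map size) -/(shape T) szE.
move=> j jT; apply: (@eq_from_nth _ 0); first by rewrite -!nth_shape szE.
move=> i ij; have := eE i.+1 j.+1; rewrite /entry /= => -> //.
rewrite -(SYCT_shape _ _ TS) /in_diagram /= size_map jT.
by rewrite nth_shape.
Qed.

(** * Peak tableaux and peak words *)

Lemma col_size_le_max i alpha : 0 < col_size i alpha -> i <= max_part alpha.
Proof.
rewrite -has_count => /hasP[a aA ia]; apply: leq_trans ia _.
exact: (leq_bigmax_seq (F := id)).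
Qed.

(** Only the last part can equal 1, so at most one row of the first column is missing from the
    second. *)
Lemma peak_col_size alpha : peak_composition alpha ->
  col_size 2 alpha <= col_size 1 alpha <= (col_size 2 alpha).+1.
Proof.
move=> [_ pk]; apply/andP; split; first by apply: sub_count => a /ltnW.
elim: alpha pk => // a alpha IH pk; rewrite /= -/(col_size 1 alpha) -/(col_size 2 alpha).
case: alpha IH pk => [|b alpha] IH pk; first by case: a {pk} => [|[]].
have /ltnW a1 := pk 1 isT; rewrite (pk 1) // a1 !add1n ltnS; apply: IH => j.
by case: j => // j jl; apply: (pk j.+2).
Qed.

(** Together with the lattice inequality for 1 and 2, this bound says that the letters 1 and 2
    alternate, beginning with 1. *)
Definition alternating (w : seq nat) : Prop :=
  forall m, m <= size w -> count_mem 1 (take m w) <= (count_mem 2 (take m w)).+1.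

(** The entries at most [k] of an increasing list form an initial segment. *)
Lemma sorted_count_le (s : seq nat) i k : sorted ltn s -> 0 < i ->
  (i <= count (fun e => e <= k) s) = (i <= size s) && (nth 0 s i.-1 <= k).
Proof.
elim: s i => [|a s IH] [|i] // srt _; rewrite /=.
case: (leqP a k) => ak; last first.
  have as_lt e : e \in s -> a < e.
    exact: (allP (order_path_min ltn_trans srt)).
  rewrite count_in_pred0 => [|e es]; last first.
    by rewrite -ltnNge; apply: ltn_trans ak (as_lt e es).
  apply/esym/negbTE/negP => /andP[il]; rewrite leqNgt => /negP; apply.
  case: i il => [|i] //= il.
  exact: ltn_trans ak (as_lt _ (mem_nth 0 il)).
rewrite add1n !ltnS; case: i => [|i]; first by rewrite /= ak.
by rewrite IH // (path_sorted srt).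
Qed.

Section SPYCT.
Variables (alpha : seq nat) (T : seq (seq nat)).
Hypotheses (comp_alpha : composition alpha) (TS : SYCT alpha T).

(** The letters 1 and 2 among the first [m] count the first two columns of the peak composition
    formed by the entries at most [m], so [peak_col_size] applies to it. *)
Lemma SPYCT_alternating : SPYCT alpha T -> alternating (f_map alpha T).
Proof.
case=> _ pk m; rewrite size_f_map => mn.
have [->|m0] := posnP m; first by rewrite take0.
have [|beta pb diag] := pk m; first by rewrite m0.
have [cb _] := pb; have /andP[_] := peak_col_size _ pb.
have bN := leq_maxl (size beta) (size alpha).
have aN := leq_maxr (size beta) (size alpha).
rewrite !(col_sizeE beta _ _ _ bN) // !(count_f_map _ _ TS _ _ _ mn aN).
by rewrite -!(eq_count (diag _)).
Qed.

(** Consider the moment [m] when row [j.+1] starts. If row [j] still lacked its second box, both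
    rows would have a first box but no second one, against alternation. *)
Lemma alternating_row2_lt j : alternating (f_map alpha T) ->
  1 <= j < size alpha -> in_diagram alpha 2 j /\ entry T 2 j < entry T 1 j.+1.
Proof.
move=> alt /andP[j0 jl]; set m := entry T 1 j.+1.
have box : in_diagram alpha 1 j.+1 by rewrite in_diagram1.
have boxj : in_diagram alpha 1 j by rewrite in_diagram1 // j0 ltnW.
have /andP[m0 mn] := SYCT_entry_range _ _ TS _ _ box.
have mj : entry T 1 j < m by apply: (SYCT_column1_lt alpha) => //; rewrite j0 ltnS /=.
suff : in_diagram alpha 2 j && (entry T 2 j <= m).
  case/andP=> box2; rewrite leq_eqVlt => /predU1P[e|]; last by [].
  have := SYCT_row_of _ _ TS _ _ box2.
  by rewrite e (SYCT_row_of _ _ TS _ _ box) => /eqP; rewrite eqn_leq ltnn.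
apply/negPn/negP => no.
have no' : ~~ (in_diagram alpha 2 j.+1 && (entry T 2 j.+1 <= m)).
  by apply/negP => /andP[box2]; rewrite leqNgt (SYCT_row_lt alpha).
have := alt m; rewrite size_f_map mn => /(_ isT).
rewrite !(count_f_map _ _ TS _ _ (size alpha)) // leqNgt => /negP; apply.
(* Rows [j] and [j.+1], added to the rows whose second box is filled, are distinct rows whose first
   box is filled. *)
rewrite -!size_filter -[_.+2]/(size [:: j, j.+1 & _]).
apply: uniq_leq_size => [|i].
  rewrite /= inE negb_or !mem_filter (negbTE no) /= andbT filter_uniq ?iota_uniq // andbT.
  by rewrite (ltn_eqF (ltnSn j)) (negbTE no').
rewrite !inE !mem_filter !mem_iota !add1n !ltnS => /or3P[/eqP->|/eqP->|].
- by rewrite boxj (ltnW mj) j0 (ltnW jl).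
- by rewrite box leqnn jl.
move=> /andP[/andP[box2 le2] ->]; rewrite andbT (in_diagramW _ _ _ _ _ box2) //=.
by apply: leq_trans le2; apply/ltnW/(SYCT_row_lt alpha).
Qed.

(** Rows and first column increase, so the boxes with entries at most [k] always form the diagram of
    a composition; alternation makes it a peak composition. *)
Lemma alternating_SPYCT : alternating (f_map alpha T) -> SPYCT alpha T.
Proof.
move=> alt; split=> // k kn; have eT := SYCT_shape _ _ TS.
have szT : size T = size alpha by rewrite -eT size_map.
have [_ _ /(all_nthP [::]) srow scol _] := TS.
have srowE j : sorted ltn (nth [::] T j).
  by case: (ltnP j (size T)) => jT; [apply: srow|rewrite nth_default].
(* [r] is the number of rows started by stage [k], and [beta] below records how far each of them is
   filled. *)
pose r := count (fun e => e <= k) [seq head 0 row | row <- T].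
have rl : r <= size alpha by rewrite -szT -(size_map (head 0)) count_size.
have rE j : 0 < j -> (j <= r) = (j <= size alpha) && (entry T 1 j <= k).
  move=> j0; rewrite /r sorted_count_le // size_map szT.
  by case: leqP => //= jl; rewrite (nth_map [::]) ?szT ?prednK // -nth0.
pose beta := [seq count (fun e => e <= k) row | row <- take r T].
have szb : size beta = r by rewrite size_map size_takel // szT.
have bE i j : 0 < i -> 0 < j <= r ->
    (i <= nth 0 beta j.-1) = in_diagram alpha i j && (entry T i j <= k).
  move=> i0 /andP[j0 jr]; have jr' : j.-1 < r by rewrite prednK.
  rewrite (nth_map [::]) ?size_takel ?szT // nth_take // sorted_count_le //.
  by rewrite -nth_shape eT /in_diagram i0 j0 (leq_trans jr rl).
have cell1 j : 0 < j <= r -> in_diagram alpha 1 j && (entry T 1 j <= k).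
  by move=> /andP[j0]; rewrite rE // in_diagram1 // j0.
exists beta.
  split.
    apply/(all_nthP 0) => j; rewrite szb => jr.
    by rewrite (bE 1 j.+1) // cell1.
  (* Row [j.+1] has started by stage [k], so the second box of row [j] was filled even earlier. *)
  move=> j; rewrite szb => /andP[j0 jr].
  have /andP[_ e1] := cell1 j.+1 jr.
  rewrite bE ?j0 ?(ltnW jr) //.
  have [|-> /ltnW e2 /=] := alternating_row2_lt j alt; last exact: leq_trans e1.
  by rewrite j0 (leq_trans jr rl).
move=> i j; rewrite {1}/in_diagram szb.
case: (posnP i) => [->|i0] /=; first by rewrite /in_diagram.
case: (posnP j) => [->|j0] /=; first by rewrite /in_diagram andbF.
case: (leqP j r) => jr /=; first by rewrite bE ?j0.
apply/esym/negbTE/negP => /andP[box ek]; move: jr; rewrite ltnNge => /negP; apply.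
have /and3P[_ /andP[_ jl] _] := box; rewrite rE // jl /=; apply: leq_trans ek.
move: i0; rewrite leq_eqVlt => /predU1P[<-//|i1].
by apply/ltnW/(SYCT_row_lt alpha).
Qed.

End SPYCT.

(** * Splitting the letter 1 by parity, and merging the letters 1 and 2 *)

Lemma size_ps w : size (ps w) = size w.
Proof. by rewrite size_map size_iota. Qed.

Lemma nth_ps w p : p < size w -> nth 0 (ps w) p =
  if nth 0 w p == 1 then if odd (count_mem 1 (take p w)) then 2 else 1
  else (nth 0 w p).+1.
Proof. by move=> pw; rewrite (nth_map 0) ?size_iota // nth_iota. Qed.

(** The 1's of [w] become 1 and 2 in turn, starting with 1, and all other letters move up to at
    least 3. *)
Lemma count_take_ps w m : all (leq 1) w -> m <= size w ->
  [/\ count_mem 1 (take m (ps w)) = uphalf (count_mem 1 (take m w)),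
      count_mem 2 (take m (ps w)) = (count_mem 1 (take m w))./2 &
      forall i, 1 < i -> count_mem i.+1 (take m (ps w)) = count_mem i (take m w)].
Proof.
move=> /(all_nthP 0) w1; elim: m => [|m IH] mw; first by rewrite !take0.
have [c1 c2 ci] := IH (ltnW mw); have /= w0 := w1 m mw.
have cS a := count_take_succ (ps w) a m; rewrite size_ps in cS.
split=> [||i i1]; rewrite cS // count_take_succ // nth_ps //.
- by rewrite c1 uphalf_half; case: (nth 0 w m =P 1) => [_|nw]; [case: ifP|]; lia.
- by rewrite c2; case: (nth 0 w m =P 1) => [_|nw]; [case: ifP|]; lia.
by rewrite ci //; case: (nth 0 w m =P 1) => [->|nw]; [case: ifP|]; lia.
Qed.

(** Applied letterwise, a left inverse of [ps] on words of positive letters. *)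
Definition merge_columns (c : nat) : nat := if c <= 2 then 1 else c.-1.

Lemma ftilde_mapE alpha T : ftilde_map alpha T = map merge_columns (f_map alpha T).
Proof. by rewrite /f_map -map_comp. Qed.

Lemma merge_columns_ps w : all (leq 1) w -> map merge_columns (ps w) = w.
Proof.
move=> /(all_nthP 0) w1; apply: (@eq_from_nth _ 0).
  by rewrite size_map size_ps.
move=> p; rewrite size_map size_ps => pw; rewrite (nth_map 0) ?size_ps // nth_ps //.
have := w1 p pw; rewrite /merge_columns; case: (nth 0 w p =P 1) => [->|]; first by case: (odd _).
by case: (nth 0 w p) => [|[|]].
Qed.

Lemma count_merge_columns1 u : all (leq 1) u ->
  count_mem 1 (map merge_columns u) = count_mem 1 u + count_mem 2 u.
Proof.
move=> u1; rewrite count_map -count_predUI [X in _ + X]count_in_pred0.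
  rewrite addn0; apply: eq_in_count => c /(allP u1) /=.
  by rewrite /merge_columns; case: c => [|[|[|c]]].
by move=> c _ /=; case: c => [|[|[|c]]].
Qed.

Lemma count_merge_columns u i : 1 < i ->
  count_mem i (map merge_columns u) = count_mem i.+1 u.
Proof.
move=> i1; rewrite count_map; apply: eq_count => c /=; rewrite /merge_columns.
by case: leqP; lia.
Qed.

(** The 1's of the merged word before [p] number the 1's plus the 2's of [w]. If [w] has 1 at [p],
    the two counts are equal and the sum is even; if it has 2, they differ by one and the sum is
    odd. *)
Lemma ps_merge_columns w : all (leq 1) w -> alternating w ->
  (forall m, m <= size w -> count_mem 2 (take m w) <= count_mem 1 (take m w)) ->
  ps (map merge_columns w) = w.
Proof.
move=> w1 alt lat; apply: (@eq_from_nth _ 0); first by rewrite size_ps size_map.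
move=> p; rewrite size_ps size_map => pw.
rewrite nth_ps ?size_map // (nth_map 0) // -map_take count_merge_columns1; last first.
  by apply/allP => x /mem_take /(allP w1).
have := alt p.+1 pw; have := lat p.+1 pw; have := lat p (ltnW pw).
have := alt p (ltnW pw); rewrite !count_take_succ // /merge_columns.
have := all_nthP 0 w1 p pw; case: (nth 0 w p) => [|[|[|c]]] //=.
- by case: ifP; lia.
- by case: ifP; lia.
Qed.

Lemma peak_lattice_ge1 w : peak_lattice_word w -> all (leq 1) w.
Proof. by case=> -[]. Qed.

Lemma ps_W_SYCT alpha w : peak_composition alpha -> W_SPYCT alpha w ->
  W_SYCT alpha (ps w).
Proof.
move=> pk [pl cnt1 cnt le con]; have w1 := peak_lattice_ge1 w pl.
have /andP[c21 c12] := peak_col_size alpha pk.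
have cps m := count_take_ps w m w1.
have tps : take (size w) (ps w) = ps w by rewrite -(size_ps w) take_size.
have := cps (size w) (leqnn _); rewrite tps take_size cnt1 => -[p1 p2 pi].
(* The column sizes differ by at most one, so the upper and lower halves of their sum are the sizes
   themselves. *)
have e1 : count_mem 1 (ps w) = col_size 1 alpha by rewrite p1; lia.
have e2 : count_mem 2 (ps w) = col_size 2 alpha by rewrite p2; lia.
split=> //.
- split.
    apply/(all_nthP 0) => p; rewrite size_ps => pw; rewrite nth_ps //.
    by case: eqP => // _; case: ifP.
  move=> u /prefixP[s e] i i0.
  have um : size u <= size w by rewrite -(size_ps w) e size_cat leq_addr.
  have -> : u = take (size u) (ps w) by rewrite e take_size_cat.
  have [d1 d2 di] := cps _ um; case: i i0 => [|[|[|i]]] // _.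
  + by rewrite d1 d2 uphalf_half leq_addl.
  (* The comparison of 2's and 3's in [ps w] is exactly the peak inequality for [w]. *)
  + rewrite d2 di //; rewrite geq_half_double -mul2n; case: pl => _; apply.
    exact: prefix_take.
  + by rewrite !di //; apply: lattice_take => //; case: pl.
- apply/(all_nthP 0) => p; rewrite size_ps => pw.
  (* The letter 1 of [w] carries no bound by [max_part alpha]; the letters 1 and 2 made from it are
     bounded because a letter that occurs belongs to a nonempty column. *)
  have posc i : i \in ps w -> 0 < count_mem i (ps w) by rewrite -has_count has_pred1.
  have mem : nth 0 (ps w) p \in ps w by rewrite mem_nth ?size_ps.
  move: mem (all_nthP 0 le p pw); rewrite nth_ps //.
  case: (nth 0 w p =P 1) => [_|nw _] /=; last by lia.
  case: (odd _) => /posc; rewrite ?e1 ?e2 => /col_size_le_max; lia.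
move=> [|[|[|i]]] // im.
by rewrite pi // cnt //; lia.
Qed.

Lemma ftilde_map_W_SPYCT alpha T : composition alpha -> SPYCT alpha T ->
  W_SPYCT alpha (ftilde_map alpha T) /\ ps (ftilde_map alpha T) = f_map alpha T.
Proof.
move=> ca TP; have [TS _] := TP; have alt := SPYCT_alternating _ _ TS TP.
have [[f1 _] fle _ fcon] := f_map_W_SYCT _ _ ca TS.
have lat i i' m := count_f_map_le _ _ TS i i' m.
have szf := size_f_map alpha T.
have f1t m : all (leq 1) (take m (f_map alpha T)).
  by apply/allP => x /mem_take /(allP f1).
have eps : ps (ftilde_map alpha T) = f_map alpha T.
  rewrite ftilde_mapE ps_merge_columns // => m mn.
  by apply: lat => //; rewrite -szf.
split=> //; split; last by rewrite eps.
- have pre u : prefix u (ftilde_map alpha T) -> exists2 m, m <= sumn alpha &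
      u = map merge_columns (take m (f_map alpha T)).
    move=> /prefixP[s e]; exists (size u).
      by rewrite -szf -(size_map merge_columns) -ftilde_mapE e size_cat leq_addr.
    by rewrite map_take -ftilde_mapE e take_size_cat.
  have pk u : prefix u (ftilde_map alpha T) -> 2 * count_mem 2 u <= count_mem 1 u.
    move=> /pre[m mn ->]; rewrite count_merge_columns1 // count_merge_columns //.
    (* The 3's of the tableau word are at most its 2's and at most its 1's, hence twice their number
       is at most the number of merged 1's. *)
    have := lat 1 2 m mn isT; have := lat 2 3 m mn isT; lia.
  split=> //; split.
    rewrite ftilde_mapE all_map; apply: sub_all f1 => c /= _.
    by rewrite /merge_columns; case: c => [|[|[|c]]].
  move=> u pu [|[|i]] // _; first by have := pk u pu; lia.
  have [m mn ->] := pre u pu; rewrite !count_merge_columns //.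
  by apply: lat => //=; lia.
- by rewrite ftilde_mapE count_merge_columns1 // !(count_f_map_all alpha).
- move=> i /andP[i2 _]; rewrite ftilde_mapE count_merge_columns //.
  by rewrite (count_f_map_all alpha).
rewrite ftilde_mapE all_map; apply: sub_all fle => c /=; rewrite /merge_columns.
by case: c => [|[|[|c]]] //=; lia.
Qed.

Theorem proposition5p5 (alpha : seq nat) (peak_alpha : peak_composition alpha) :
  set_bij (SPYCT alpha) (W_SPYCT alpha) (ftilde_map alpha) /\
  [/\ set_fun (SPYCT alpha) (SYCT alpha) iota_map,
      set_fun (SYCT alpha) (W_SYCT alpha) (f_map alpha),
      set_fun (W_SPYCT alpha) (W_SYCT alpha) iotabar_map &
      {in SPYCT alpha,
        iotabar_map \o ftilde_map alpha =1 f_map alpha \o iota_map}].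
Proof.
have [ca _] := peak_alpha.
split; split.
- by move=> T /(ftilde_map_W_SPYCT _ _ ca)[].
(* Injectivity: [ps] recovers the word under [f_map], which determines the tableau. *)
- move=> T T'; rewrite !inE => TP TP' e.
  apply: (f_map_inj alpha) => //; [by case: TP|by case: TP'|].
  have [_ <-] := ftilde_map_W_SPYCT _ _ ca TP.
  by have [_ <-] := ftilde_map_W_SPYCT _ _ ca TP'; rewrite e.
(* Surjectivity: the preimage of [w] is the tableau whose word under [f_map] is [ps w]. *)
- move=> w wP; have wW := ps_W_SYCT _ _ peak_alpha wP.
  have w1 : all (leq 1) w by case: wP => /peak_lattice_ge1.
  have TS := tableau_of_labels_SYCT _ _ ca wW.
  have fT := f_map_tableau_of_labels _ _ ca wW.
  exists (tableau_of_labels (size alpha) (rs (ps w))); last first.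
    by rewrite ftilde_mapE fT merge_columns_ps.
  apply: alternating_SPYCT => //; rewrite fT => m; rewrite size_ps => mw.
  (* Alternation of [ps w] holds because the upper half of a number exceeds its lower half by at
     most one. *)
  by have [-> -> _] := count_take_ps w m w1 mw; lia.
- by move=> T [].
- by move=> T TS; apply: f_map_W_SYCT.
- by move=> w; apply: ps_W_SYCT.
by move=> T; rewrite inE => /(ftilde_map_W_SPYCT _ _ ca)[].
Qed.
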